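(* Let $X$ be a regular curve, let $f:X\to X$ be a homeomorphism, and let $(M_n)_n$ be a sequence of minimal sets of $f$ that converges with respect to the Hausdorff metric to some $M\in 2^X$. Then $M$ is a minimal set of $f$.
   Context: A continuum is a nonempty connected compact metric space. A continuum $X$ is a regular curve if for each $x\in X$ and each open neighborhood $V$ of $x$ in $X$ there is an open neighborhood $U$ of $x$ in $X$ with $U\subset V$ and with finite boundary $\partial U$. $2^X$ denotes the hyperspace of all nonempty closed subsets of $X$, endowed with the Hausdorff metric $d_H(A,B)=\max\{\sup_{x\in A}d(x,B),\sup_{y\in B}d(y,A)\}$. A subset $M\subset X$ is minimal for $f$ if it is nonempty, closed and strongly invariant ($f(M)=M$), and no proper subset of $M$ has these three properties. *)

(* Defs.v *)
From HB Require Import structures.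
From mathcomp Require Import all_boot all_order all_algebra.
From mathcomp Require Import all_classical all_reals all_analysis.

Set Implicit Arguments.
Unset Strict Implicit.
Unset Printing Implicit Defensive.

Import Order.TTheory GRing.Theory Num.Theory.
Import numFieldNormedType.Exports.

Local Open Scope classical_set_scope.
Local Open Scope ring_scope.

Section Topology.
Context {R : realType}.

Definition boundary {T : topologicalType} (U : set T) : set T :=
  closure U `\` interior U.

Definition continuum (X : metricType R) : Prop :=
  [/\ [set: X] !=set0, connected [set: X] & compact [set: X]].

Definition regular_curve (X : metricType R) : Prop :=
  continuum X /\
  forall (x : X) (V : set X), open_nbhs x V ->
    exists U : set X,
      [/\ open_nbhs x U, U `<=` V & finite_set (boundary U)].

Definition homeomorphism {S T : topologicalType} (f : S -> T) : Prop :=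
  continuous f /\
  exists g : T -> S, [/\ cancel f g, cancel g f & continuous g].

End Topology.

Section Hyperspace.
Context {R : realType} {X : metricType R}.

Definition hyperspace : set (set X) := [set A | A !=set0 /\ closed A].

Definition dist_to_set (x : X) (A : set X) : R := inf [set mdist x a | a in A].

(* Real-valued [inf] and [sup] return 0 when the bound does not exist, so this
   is the Hausdorff distance only for nonempty bounded sets; on a compact [X]
   this covers all of [hyperspace]. *)
Definition hausdorff_dist (A B : set X) : R :=
  Num.max (sup [set dist_to_set x B | x in A])
          (sup [set dist_to_set y A | y in B]).

End Hyperspace.

Section Dynamics.
Context {T : topologicalType}.

Definition closed_invariant (f : T -> T) (A : set T) : Prop :=
  [/\ A !=set0, closed A & f @` A = A].

Definition minimal_set (f : T -> T) (M : set T) : Prop :=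
  closed_invariant f M /\ forall N, N `<` M -> ~ closed_invariant f N.

End Dynamics.

(* Main.v *)
Require Import Defs.
From HB Require Import structures.
From mathcomp Require Import all_boot all_order all_algebra.
From mathcomp Require Import finmap.
From mathcomp Require Import all_classical all_reals all_analysis.

(* Let g be the inverse of f, and let N be a closed invariant proper subset of
   the limit M. Points outside N are separated from N by open sets with finite
   boundary; call the number of boundary points the size of such a cut. Sizes
   are submodular, so if a minimal cut D of v contains a, then the union of D
   with a minimal cut of a is again a minimal cut of v.
   For q in M outside N this yields a cut D of q whose forward iterates have a
   union U with finite boundary. If f^h q lies in a minimal cut of q for some
   h > 0, absorption bounds the boundaries of the finite unions of the f^(ih) D.
   Otherwise the points f^i q would have pairwise different minimal cuts, and
   recurrence of some M_n puts a point in infinitely many of them, which is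
   impossible.
   Every M_n meeting D lies in U, so M is contained in the closure of U. Hence
   N, which misses U, is contained in the finite boundary of U; and taking N to
   be the alpha-limit set of q shows that every q in M is recurrent under g.
   Finally, if N is nonempty, the M_n come close to N and leave it again, which
   gives a point z of M outside a small neighbourhood V of N whose strictly
   backward orbit stays in the closure of V. Points of M whose whole orbit stays
   near N form a proper closed invariant set, hence a finite one, so V can be
   chosen such that those in the closure of V belong to N. As z is recurrent it
   is one of them, a contradiction. *)

Set Implicit Arguments.
Unset Strict Implicit.
Unset Printing Implicit Defensive.

Import Order.TTheory GRing.Theory Num.Theory.
Import numFieldNormedType.Exports.

Local Open Scope classical_set_scope.

(** * Finite boundaries *)

(** Connectedness im kleinen at every point, which is equivalent to local connectedness. *)
Definition connected_nbhs (T : topologicalType) : Prop :=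
  forall (x : T) V, nbhs x V -> exists Z, [/\ nbhs x Z, Z `<=` V & connected Z].

(** [fset_set] sends an infinite set to the empty one, so this size is meaningful only together with
    finiteness of the boundary. *)
Definition bsize (T : topologicalType) (D : set T) : nat :=
  #|` fset_set (boundary D)|%fset.

Section Boundaries.
Context {T : topologicalType}.
Implicit Types (D E Z : set T) (x y z : T).

Lemma open_boundaryE D : open D -> boundary D = closure D `\` D.
Proof. by move=> /interior_id oD; rewrite /boundary oD. Qed.

Lemma boundary_union_sub D E :
  boundary (D `|` E) `<=` boundary D `|` boundary E.
Proof.
move=> z []; rewrite closureU => zDE zi.
have [zD|zD] := pselect (D° z); first by case: zi; apply: filterS zD => ? ?; left.
have [zE|zE] := pselect (E° z); first by case: zi; apply: filterS zE => ? ?; right.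
by case: zDE => ?; [left|right]; split.
Qed.

Lemma boundary_inter_sub D E :
  boundary (D `&` E) `<=` boundary D `|` boundary E.
Proof.
move=> z [cz zi].
have cD : closure D z by apply: closure_subset cz => ? [].
have cE : closure E z by apply: closure_subset cz => ? [].
have [zD|zD] := pselect (D° z); last by left; split.
have [zE|zE] := pselect (E° z); last by right; split.
by case: zi; apply: filterI.
Qed.

Lemma boundary_union_inter D E : open D -> open E ->
  boundary (D `|` E) `&` boundary (D `&` E) `<=` boundary D `&` boundary E.
Proof.
move=> oD oE z; rewrite !open_boundaryE//; [|exact: openI|exact: openU].
move=> [[_ nz] [cz _]]; split; split.
- by apply: closure_subset cz => ? [].
- by move=> Dz; apply: nz; left.
- by apply: closure_subset cz => ? [].
- by move=> Ez; apply: nz; right.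
Qed.

(** Inclusion-exclusion on both sides: the boundaries of the union and of the intersection have
    their union inside the union, and their intersection inside the intersection, of [boundary D]
    and [boundary E]. *)
Lemma bsize_submodular D E : open D -> open E ->
  finite_set (boundary D) -> finite_set (boundary E) ->
  (bsize (D `|` E) + bsize (D `&` E) <= bsize D + bsize E)%N.
Proof.
move=> oD oE fD fE.
have fDE : finite_set (boundary D `|` boundary E) by rewrite finite_setU.
have fU := sub_finite_set (@boundary_union_sub D E) fDE.
have fI := sub_finite_set (@boundary_inter_sub D E) fDE.
rewrite /bsize -cardfsUI -(cardfsUI (fset_set (boundary D))).
apply: leq_add; rewrite -?fset_setU -?fset_setI//;
  apply: fsubset_leq_card; rewrite -fset_set_sub//.
- by rewrite subUset; split; [exact: boundary_union_sub|exact: boundary_inter_sub].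
- by rewrite finite_setU.
- exact: boundary_union_inter.
- exact: finite_setIl.
- exact: finite_setIl.
Qed.

(** Otherwise [Z] meets [D] and [closure D] in the same set, which is then clopen in [Z]. *)
Lemma connected_meets_boundary Z D : connected Z -> open D ->
  Z `&` D !=set0 -> ~ (Z `<=` D) -> Z `&` boundary D !=set0.
Proof.
move=> cZ oD ZD nZD; apply: contrapT => Zb; apply: nZD.
suff: Z `&` D = Z by move=> <- ? [].
apply: cZ => //; first by exists D.
exists (closure D); first exact: closed_closure.
apply/seteqP; split=> z [Zz Dz]; split=> //; first exact: subset_closure.
by apply: contrapT => nDz; apply: Zb; exists z; rewrite open_boundaryE.
Qed.

Lemma hausdorff_disjoint_nbhs (S : {fset T}) : hausdorff_space T ->
  exists W : T -> set T, (forall z, nbhs z (W z)) /\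
    {in S &, forall z z', W z `&` W z' !=set0 -> z = z'}.
Proof.
rewrite open_hausdorff => hT.
have /choice[B BP] (p : T * T) : exists B : set T * set T, p.1 != p.2 ->
    [/\ nbhs p.1 B.1, nbhs p.2 B.2 & B.1 `&` B.2 = set0].
  have [xy|xy] := eqVneq p.1 p.2.
    by exists (set0, set0) => /eqP.
  have [[A C]/= [xA yC] [oA oC /eqP AC]] := hT _ _ xy.
  by exists (A, C) => _; split => //=; apply: open_nbhs_nbhs; split=> //;
    rewrite -in_setE.
(* The choice [B] need not be symmetric in the pair, so [W z] takes the first component of
   [B (z, z')] and the second one of [B (z', z)]. *)
pose W z := \bigcap_(z' in [set` S]) [set w | z != z' ->
  ((B (z, z')).1 `&` (B (z', z)).2) w].
exists W; split=> [z|z z' zs z's [w [Ww W'w]]].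
  apply: filter_bigI => z' _; have [zz'|zz'] := eqVneq z z'.
    by rewrite -zz'; apply: filterS filterT => w.
  have [Bz _ _] := BP (z, z') zz'.
  have [|_ B'z _] := BP (z', z); first by rewrite eq_sym.
  by apply: filterS (filterI Bz B'z) => w Bw _.
apply/eqP/negPn/negP => zz'.
have [_ _ B0] := BP (z, z') zz'.
suff : ((B (z, z')).1 `&` (B (z, z')).2) w by rewrite B0.
split; first by have [] := Ww z' z's zz'.
by have [|] := W'w z zs; rewrite // eq_sym.
Qed.

(** Given [k.+1] boundary points of [L] with disjoint connected neighbourhoods, pick in each a point
    of [L] and a point outside. A [D] agreeing with [L] at the picked points has a boundary point in
    each neighbourhood, which is too many. *)
Lemma finite_boundary_limit (L : set T) k :
  hausdorff_space T -> connected_nbhs T ->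
  (forall s : seq T, exists D,
    [/\ open D, finite_set (boundary D), (bsize D <= k)%N &
        {in s, forall z, D z <-> L z}]) ->
  finite_set (boundary L).
Proof.
move=> hT cT approx; apply: contrapT => /(infinite_set_fset k.+1)[S SL kS].
have [W [Wn Wd]] := hausdorff_disjoint_nbhs S hT.
have /choice[Z ZP] : forall z, exists Z, [/\ nbhs z Z, Z `<=` W z & connected Z].
  by move=> z; apply: cT.
have /choice[a aP] : forall z, exists a, z \in S -> Z z a /\ L a.
  move=> z; have [zS|] := boolP (z \in S); last by exists z.
  have [cz _] := SL _ zS; have [Zz _ _] := ZP z.
  by have [a [La Za]] := cz _ Zz; exists a.
have /choice[b bP] : forall z, exists b, z \in S -> Z z b /\ ~ L b.
  move=> z; have [zS|] := boolP (z \in S); last by exists z.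
  have [_ zi] := SL _ zS; have [Zz _ _] := ZP z.
  apply: contrapT => nb; apply: zi; apply: filterS Zz => b Zb.
  by apply: contrapT => Lb; apply: nb; exists b.
have [D [oD fD Dk DL]] := approx (map a S ++ map b S).
have /choice[c cP] : forall z, exists c, z \in S -> Z z c /\ boundary D c.
  move=> z; have [zS|] := boolP (z \in S); last by exists z.
  have [Zz _ Zc] := ZP z; have [Za La] := aP z zS; have [Zb Lb] := bP z zS.
  have [|ZD|c [Zc' Dc]] := connected_meets_boundary Zc oD; last by exists c.
  - exists (a z); split=> //; apply/DL => //.
    by rewrite mem_cat map_f.
  - apply: Lb; apply/DL; last exact: ZD.
    by rewrite mem_cat map_f ?orbT.
have cinj : {in S &, injective c}.
  move=> z z' zS z'S czz'; apply: Wd => //; exists (c z).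
  have [[Zc _] [Z'c _]] := (cP z zS, cP z' z'S).
  have [[_ ZW _] [_ ZW' _]] := (ZP z, ZP z').
  by split; [exact: ZW|rewrite czz'; exact: ZW'].
suff : (k.+1 <= k)%N by rewrite ltnn.
apply: leq_trans kS _; apply: leq_trans Dk; rewrite -(card_in_imfset imfset_key cinj)//.
apply: fsubset_leq_card; apply/fsubsetP => _ /imfsetP[z /= zS ->].
by rewrite in_fset_set// inE; have [] := cP z zS.
Qed.

End Boundaries.

(** * Local connectedness *)

Section LocalConnectedness.
Context {T : topologicalType}.
Implicit Types (A D U V Z : set T) (x y z : T).

Lemma connected_nbhs_of_finite_boundary :
  connected [set: T] -> regular_space T ->
  (forall x V, open_nbhs x V -> exists U : set T,
      [/\ open_nbhs x U, U `<=` V & finite_set (boundary U)]) ->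
  connected_nbhs T.
Proof.
move=> cT rT reg x V /rT[W xW WV].
have [U [[oU Ux] UW fU]] := reg x W° (conj (open_interior W) xW).
have KV : closure U `<=` V.
  by apply: subset_trans WV; apply: closure_subset; apply: subset_trans UW _;
     exact: interior_subset.
(* a relatively clopen part of [closure U] around [x] with as few boundary
   points of [U] as possible is connected: a part of it missing [boundary U]
   would be clopen in [T] *)
pose P n := `[< exists A, [/\ A x, closed A,
  exists2 G, open G & A = closure U `&` G &
  #|` fset_set (A `&` boundary U)|%fset = n] >].
have exP : exists n, P n.
  exists #|` fset_set (closure U `&` boundary U)|%fset; apply/asboolP.
  exists (closure U); split=> //; first exact: subset_closure.
    exact: closed_closure.
  by exists setT; [exact: openT|rewrite setIT].
case: (ex_minnP exP) => n /asboolP[A [Ax cA [G oG AG] An]] nmin.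
have Gx : G x by move: Ax; rewrite AG => -[].
exists A; split.
- rewrite AG; apply: filterI; last exact: open_nbhs_nbhs.
  by apply: filterS (@subset_closure _ U) _; exact: open_nbhs_nbhs.
- by rewrite AG => y [/KV].
have key A1 A2 G2 : A = A1 `|` A2 -> A1 `&` A2 = set0 -> A1 x ->
    A2 !=set0 -> closed A1 -> closed A2 ->
    (exists2 G1, open G1 & A1 = A `&` G1) -> open G2 -> A2 = A `&` G2 -> False.
  move=> A12 A120 A1x A2n cA1 cA2 [G1 oG1 AG1] oG2 AG2.
  have [[b [A2b Ub]]|nU] := pselect ((A2 `&` boundary U) !=set0).
    have /nmin : P #|` fset_set (A1 `&` boundary U)|%fset.
      apply/asboolP; exists A1; split=> //; exists (G `&` G1); first exact: openI.
      by rewrite AG1 AG setIA.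
    rewrite leqNgt => /negP; apply; rewrite -An; apply: fproper_ltn_card.
    have f1 : finite_set (A1 `&` boundary U) by exact: finite_setIr.
    have f2 : finite_set (A `&` boundary U) by exact: finite_setIr.
    rewrite fproperE; apply/andP; split; last apply/negP; rewrite -fset_set_sub//.
      by rewrite A12 => y [A1y Uy]; split=> //; left.
    move=> /(_ b)[|A1b _]; first by split=> //; rewrite A12; right.
    by suff : (A1 `&` A2) b by rewrite A120.
  have A2U : A2 `<=` U.
    move=> y A2y; apply: contrapT => nUy; apply: nU; exists y; split=> //.
    rewrite open_boundaryE//; split=> //.
    by have : A y by [rewrite A12; right]; rewrite AG => -[].
  have A2T : A2 = setT.
    apply: cT => //; last by exists A2; rewrite ?setTI.
    exists (U `&` (G `&` G2)); first by apply: openI => //; exact: openI.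
    rewrite setTI AG2 AG; apply/seteqP; split=> [y [[Ky Gy] G2y]|y [Uy [Gy G2y]]].
      by do !split => //; apply: A2U; rewrite AG2 AG.
    by do !split => //; exact: subset_closure.
  by have : (A1 `&` A2) x; [rewrite A2T; split | rewrite A120].
move=> B Bn [G1 oG1 BG] [C cC BC]; apply: contrapT => BA.
have BsA : B `<=` A by rewrite BG => ? [].
have ADn : (A `\` B) !=set0.
  by apply: contrapT => n0; apply: BA; apply/seteqP; split=> // y Ay;
    apply: contrapT => nBy; apply: n0; exists y.
have cB : closed B by rewrite BC; exact: closedI.
have cAB : closed (A `\` B).
  rewrite BG setDIr setDv set0U setDE; apply: closedI => //; exact: open_closedC.
have AB : A `\` B = A `&` ~` C.
  by rewrite BC setDIr setDv set0U setDE.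
have [Bx|nBx] := pselect (B x).
- apply: (key B (A `\` B) (~` C)) => //; last exact: closed_openC.
  + by rewrite setDUK.
  + by rewrite -subset0 => y [By []].
  + by exists G1.
- apply: (key (A `\` B) B G1) => //.
  + by rewrite setDKU.
  + by rewrite -subset0 => y [[_ nBy]].
  + by exists (~` C) => //; exact: closed_openC.
Qed.

Lemma open_connected_component D x : connected_nbhs T -> open D ->
  open (connected_component D x).
Proof.
move=> cT oD; rewrite openE => y Cy.
have Dy := connected_component_sub Cy.
have [Z [Zy ZD cZ]] := cT y D (open_nbhs_nbhs (conj oD Dy)).
apply: (filterS _ Zy) => z Zz.
have yz := connected_component_max (nbhs_singleton Zy) ZD cZ Zz.
exact: connected_component_trans Cy yz.
Qed.

(** A boundary point of the component lying in [D] would have a connected neighbourhood in [D] that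
    meets the component, and so would belong to it. *)
Lemma connected_component_boundary D x : connected_nbhs T -> open D ->
  boundary (connected_component D x) `<=` boundary D.
Proof.
move=> cT oD; have oC := open_connected_component x cT oD.
rewrite !open_boundaryE// => z [cz nCz]; split.
  by apply: closure_subset cz; exact: connected_component_sub.
move=> Dz; apply: nCz.
have [Z [Zz ZD cZ]] := cT z D (open_nbhs_nbhs (conj oD Dz)).
have [y [Cy Zy]] := cz _ Zz.
have zy := connected_component_max (nbhs_singleton Zz) ZD cZ Zy.
exact: connected_component_trans Cy (connected_component_sym zy).
Qed.

End LocalConnectedness.

(** * Minimal finite cuts *)

Section Cuts.
Context {T : topologicalType}.
Implicit Types (N D E F : set T) (v a : T).

(** The condition on the closure leaves an open neighbourhood of [N] disjoint from [D], as used in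
    [limit_recurrent]. *)
Definition finite_cut N v D : Prop :=
  [/\ open D, D v, closure D `<=` ~` N & finite_set (boundary D)].

Definition mincut N v D : Prop :=
  finite_cut N v D /\ forall E, finite_cut N v E -> (bsize D <= bsize E)%N.

Lemma mincut_exists N v D : finite_cut N v D -> exists E, mincut N v E.
Proof.
move=> cD; pose P n := `[< exists2 E, finite_cut N v E & bsize E = n >].
have exP : exists n, P n by exists (bsize D); apply/asboolP; exists D.
case: (ex_minnP exP) => n /asboolP[E cE <-] nmin.
by exists E; split=> // F cF; apply: nmin; apply/asboolP; exists F.
Qed.

Lemma mincut_bsize N v D E : mincut N v D -> mincut N v E -> bsize D = bsize E.
Proof.
by move=> [cD Dmin] [cE Emin]; apply/eqP; rewrite eqn_leq Dmin// Emin.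
Qed.

Lemma mincut_leq N v D E : mincut N v D -> finite_cut N v E ->
  (bsize E <= bsize D)%N -> mincut N v E.
Proof.
by move=> [_ Dmin] cE ED; split=> // F /Dmin; exact: leq_trans.
Qed.

(** The intersection of [D] and [F] is a cut of [a], hence at least as large as [F]; by
    submodularity the union is at most as large as [D]. *)
Lemma mincutU N v a D F : mincut N v D -> mincut N a F -> D a ->
  mincut N v (D `|` F).
Proof.
move=> mD [[oF Fa FN fF] Fmin] Da; have [[oD Dv DN fD] _] := mD.
apply: (mincut_leq mD).
  split; [exact: openU|by left|by rewrite closureU subUset|].
  by apply: sub_finite_set (@boundary_union_sub _ D F) _; rewrite finite_setU.
have /Fmin : finite_cut N a (D `&` F).
  split; [exact: openI|by []| |].
    by apply: subset_trans DN; apply: closure_subset => ? [].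
  by apply: sub_finite_set (@boundary_inter_sub _ D F) _; rewrite finite_setU.
have := bsize_submodular oD oF fD fF; rewrite addnC => le1 le2.
by rewrite -(leq_add2r (bsize F)) (leq_trans _ le1)// addnC leq_add2r.
Qed.

(** Absorption with [a = v]: the union of two minimal cuts of [v] is again one. *)
Lemma mincut_cover N v (s : seq T) : (exists D, mincut N v D) ->
  (forall z, z \in s -> exists2 D, mincut N v D & D z) ->
  exists2 D, mincut N v D & forall z, z \in s -> D z.
Proof.
move=> [D0 mD0]; elim: s => [|z s IH] zs; first by exists D0.
have [|D mD Ds] := IH; first by move=> y ys; apply: zs; rewrite in_cons ys orbT.
have [|E mE Ez] := zs z; first exact: mem_head.
exists (D `|` E); first by apply: (mincutU mD mE); have [[]] := mD.
by move=> y; rewrite in_cons => /predU1P[->|/Ds]; [right|left].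
Qed.

Lemma mincut_component N v D : connected_nbhs T -> mincut N v D ->
  mincut N v (connected_component D v).
Proof.
move=> cT mD; have [[oD Dv DN fD] _] := mD.
have sb := @connected_component_boundary _ D v cT oD.
have fC := sub_finite_set sb fD.
apply: (mincut_leq mD); last first.
  by apply: fsubset_leq_card; rewrite -fset_set_sub.
split => //; [exact: open_connected_component|exact: connected_component_refl|].
apply: subset_trans DN; apply: closure_subset; exact: connected_component_sub.
Qed.

End Cuts.

(** * Cuts under a homeomorphism; preimages under [g] serve as images under [f] *)

Section Transport.
Context {T : topologicalType} (f g : T -> T).
Hypotheses (fK : cancel f g) (gK : cancel g f).
Hypotheses (cf : continuous f) (cg : continuous g).
Implicit Types (N D E : set T) (v : T).

Lemma closure_preimage D : closure (g @^-1` D) = g @^-1` closure D.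
Proof.
apply/seteqP; split=> z cz.
  by move=> B /cg /cz[y [Dy By]]; exists (g y).
move=> B Bz; have /cz[y [Dy By]] : nbhs (g z) (f @^-1` B).
  by apply: cf; rewrite gK.
by exists (f y); split=> //; rewrite /preimage/= fK.
Qed.

Lemma interior_preimage D : (g @^-1` D)° = g @^-1` D°.
Proof.
by rewrite -[D]setCK -preimage_setC !interiorC closure_preimage preimage_setC.
Qed.

Lemma boundary_preimage D : boundary (g @^-1` D) = g @^-1` boundary D.
Proof. by rewrite /boundary closure_preimage interior_preimage. Qed.

Lemma card_eq_preimage D : (g @^-1` D #= D)%card.
Proof.
have -> : g @^-1` D = f @` D.
  apply/seteqP; split=> [z Dz|_ [z Dz <-]]; first by exists (g z).
  by rewrite /preimage/= fK.
by apply: inj_card_eq => x y _ _ /(can_inj fK).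
Qed.

Lemma finite_preimage_homeo D : finite_set D -> finite_set (g @^-1` D).
Proof. by rewrite -(eq_finite_set (card_eq_preimage D)). Qed.

Lemma bsize_preimage D : finite_set (boundary D) -> bsize (g @^-1` D) = bsize D.
Proof.
move=> fD; rewrite /bsize boundary_preimage; apply/fcard_eq => //.
  exact: finite_preimage_homeo.
exact: card_eq_preimage.
Qed.

Lemma cut_preimage N v D : (forall z, N (f z) <-> N z) ->
  finite_cut N v D -> finite_cut N (f v) (g @^-1` D).
Proof.
move=> Nf [oD Dv DN fD]; split.
- exact: open_comp.
- by rewrite /preimage/= fK.
- rewrite closure_preimage => z /DN/= nN Nz; apply: nN.
  by apply/Nf; rewrite gK.
- by rewrite boundary_preimage; exact: finite_preimage_homeo.
Qed.

End Transport.

(** * Forward unions of cuts *)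

Lemma iter_can (T : Type) (f g : T -> T) : cancel f g ->
  forall i, cancel (iter i f) (iter i g).
Proof. by move=> fK; elim=> // i IH x; rewrite iterSr iterS fK IH. Qed.

Section Iterates.
Context {T : topologicalType} (f g : T -> T).
Hypotheses (fK : cancel f g) (gK : cancel g f).
Hypotheses (cf : continuous f) (cg : continuous g).
Implicit Types (N D E : set T) (v : T).

(** A competing cut of [f v] is pulled back by [f] to a cut of [v] of the same size. *)
Lemma mincut_preimage N v D : (forall z, N (f z) <-> N z) ->
  mincut N v D -> mincut N (f v) (g @^-1` D).
Proof.
move=> Nf [cD Dmin]; split; first exact: (cut_preimage fK gK cf cg).
have Ng z : N (g z) <-> N z by rewrite -(Nf (g z)) gK.
move=> E cE; have [_ _ _ fD] := cD; have [_ _ _ fE] := cE.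
rewrite (bsize_preimage fK gK cf cg)//.
rewrite -(bsize_preimage gK fK cg cf fE); apply: Dmin.
by have := cut_preimage gK fK cg cf Ng cE; rewrite fK.
Qed.

Lemma iter_continuous i : continuous (iter i f).
Proof.
elim: i => [|i IH] x /=; first exact: cvg_id.
by apply: (@continuous_comp _ _ _ (iter i f) f); [exact: IH|exact: cf].
Qed.

Lemma iter_preimageS i D : iter i.+1 g @^-1` D = g @^-1` (iter i g @^-1` D).
Proof. by apply/seteqP; split=> z; rewrite /preimage/= -iterS iterSr. Qed.

Lemma mincut_iter N v D i : (forall z, N (f z) <-> N z) ->
  mincut N v D -> mincut N (iter i f v) (iter i g @^-1` D).
Proof.
move=> Nf mD; elim: i => // i IH.
by rewrite iter_preimageS /=; exact: mincut_preimage.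
Qed.

Lemma iter_invariant N i z : (forall z, N (f z) <-> N z) ->
  N (iter i f z) <-> N z.
Proof. by move=> Nf; elim: i => //= i <-; exact: Nf. Qed.

End Iterates.

Lemma boundary_set0 (T : topologicalType) : boundary (@set0 T) = set0.
Proof. by rewrite /boundary closure0 set0D. Qed.

Lemma finite_boundary_bigcup (T : topologicalType) (A : nat -> set T) n :
  (forall i, finite_set (boundary (A i))) ->
  finite_set (boundary (\bigcup_(i < n) A i)).
Proof.
move=> fA; rewrite bigcup_mkord.
apply: (big_ind (fun D => finite_set (boundary D))) => //.
  by rewrite boundary_set0.
move=> D E fD fE; apply: sub_finite_set (@boundary_union_sub _ D E) _.
by rewrite finite_setU.
Qed.

Section ForwardUnion.
Context {T : topologicalType} (f g : T -> T).
Hypotheses (fK : cancel f g) (gK : cancel g f).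
Hypotheses (cf : continuous f) (cg : continuous g).
Hypotheses (hT : hausdorff_space T) (cT : connected_nbhs T).
Context (N : set T).
Hypothesis Nf : forall z, N (f z) <-> N z.

(** The union of all forward iterates of [D], written so that membership of [z] says that the
    [g]-orbit of [z] enters [D]. *)
Definition forward_union (D : set T) : set T := \bigcup_i (iter i g @^-1` D).

Lemma finite_boundary_periodic q D h : (0 < h)%N ->
  mincut N q D -> D (iter h f q) -> finite_set (boundary (forward_union D)).
Proof.
move=> h0 mD Dh; pose A i := iter (i * h) g @^-1` D.
pose U m := \big[setU/set0]_(i < m.+1) A i.
have AU m i : (i <= m)%N -> A i `<=` U m.
  by move=> im; rewrite /U -bigcup_mkord => z Az; exists i.
have mU m : mincut N q (U m).
  elim: m => [|m IH]; first by rewrite /U big_ord1.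
  rewrite /U big_ord_recr; apply: (mincutU IH).
    exact: mincut_iter (Nf) mD.
  (* The next cut is centred at [iter (m * h) f (iter h f q)], which lies in [A m] because [D]
     contains [iter h f q]. *)
  apply: (AU m m) => //; rewrite /A/preimage/= mulSn addnC iterD.
  by rewrite (iter_can fK).
have fA : finite_set (boundary (\bigcup_i A i)).
  apply: (finite_boundary_limit (k := bsize D)) => // s.
  have [m Um] : exists m, forall z, z \in s -> (\bigcup_i A i) z -> U m z.
    elim: s => [|z s [m IH]]; first by exists 0%N.
    have [[i _ Aiz]|nz] := pselect ((\bigcup_i A i) z); last first.
      by exists m => y; rewrite in_cons => /predU1P[->|/IH].
    exists (maxn i m) => y; rewrite in_cons => /predU1P[-> _|/IH ys /ys].
      by apply: AU Aiz; exact: leq_maxl.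
    by rewrite /U -bigcup_mkord => -[j jm Aj]; apply: AU Aj;
      rewrite (leq_trans _ (leq_maxr i m)).
  exists (U m); have [[oU _ _ fU] _] := mU m; split=> //.
    by rewrite (mincut_bsize (mU m) mD).
  move=> z zs; split; last exact: Um.
  by rewrite /U -bigcup_mkord => -[j _ Aj]; exists j.
(* Splitting times by their residue modulo [h] leaves finitely many homeomorphic copies of the union
   of the [A i]. *)
have -> : forward_union D =
    \bigcup_(r < h) (iter r g @^-1` (\bigcup_i A i)).
  apply/seteqP; split=> [z [i _ Diz]|z [r _ [i _ Diz]]].
    exists (i %% h)%N; first by rewrite /= ltn_mod.
    by exists (i %/ h)%N => //; rewrite /A/preimage/= -iterD -divn_eq.
  by exists (i * h + r)%N => //; rewrite /preimage/= iterD.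
apply: finite_boundary_bigcup => r.
have iK := iter_can fK r; have iK' := iter_can gK r.
have ic := @iter_continuous _ f cf r; have ic' := @iter_continuous _ g cg r.
rewrite (boundary_preimage iK iK' ic ic').
exact: (finite_preimage_homeo iK iK').
Qed.

(* The case where [q] returns to none of its own minimal cuts. The minimal cuts
   of the points of the orbit of [q] are then all different, and no point can
   lie in infinitely many of them: the ultrafilter limit of the unions of these
   cuts would be open with finite boundary, yet contain a boundary point. *)
Lemma minimal_cut_returns q y D0 : mincut N q D0 -> connected D0 ->
  (forall m, exists2 i, (m <= i)%N & D0 (iter i g y)) ->
  exists h D, [/\ (0 < h)%N, mincut N q D & D (iter h f q)].
Proof.
move=> mD0 cD0 yD0; apply: contrapT => noret.
pose v i := iter i f q; pose A i := iter i g @^-1` D0.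
have mA i : mincut N (v i) (A i) by exact: mincut_iter.
pose G i z := exists2 D, mincut N (v i) D & D z.
have bA i D : mincut N (v i) D -> bsize D = bsize D0.
  move=> /mincut_bsize/(_ (mA i)) ->.
  have [[_ _ _ fD] _] := mD0.
  exact: (bsize_preimage (iter_can fK i) (iter_can gK i)
            (@iter_continuous _ f cf i) (@iter_continuous _ g cg i) fD).
have Glt i h : (0 < h)%N -> ~ G i (v (h + i)%N).
  move=> h0 [D mD Dh]; apply: noret; exists h, (iter i f @^-1` D).
  split=> //; last by rewrite /preimage/= -iterD addnC.
  have Ng z : N (g z) <-> N z by rewrite -(Nf (g z)) gK.
  by have := mincut_iter gK fK cg cf i Ng mD; rewrite /v (iter_can fK).
have Gdistinct i j : i != j -> ~ G i (v j).
  rewrite neq_ltn => /orP[ij|ji].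
    by rewrite -(subnK (ltnW ij)); apply: Glt; rewrite subn_gt0.
  (* All these minimal cuts have the same size, so a minimal cut of [v i] containing [v j] is also
     one of [v j], and the roles can be exchanged. *)
  move=> [D mD Dj]; apply: (@Glt j (i - j)%N); first by rewrite subn_gt0.
  rewrite (subnK (ltnW ji)); exists D; last by have [[]] := mD.
  have [[oD _ DN fD] _] := mD.
  by apply: (mincut_leq (mA j)) => //; rewrite (bA _ _ mD) (bA _ _ (mA j)).
pose J := [set i | A i y].
(* [J] is infinite, so some ultrafilter [U] contains [J] and all final segments of the indices. *)
have PF : ProperFilter (within J \oo).
  split; last exact: within_filter.
  by move=> -[m _ mJ]; have [i mi Ai] := yD0 m; exact: (mJ i mi Ai).
have [U [UU JU]] := ultraFilterLemma PF.
have UJ : U J by apply: JU; exists 0%N.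
have Uge m : U [set i | (m <= i)%N] by apply: JU; exists m.
pose L := [set z | U [set i | G i z]].
have LU (s : seq T) : U [set i | {in s, forall z, G i z <-> L z}].
  elim: s => [|z s IH]; first by apply: filterS filterT.
  have Uz : U [set i | G i z <-> L z].
    have [Lz|nLz] := in_ultra_setVsetC [set i | G i z] UU.
      by apply: filterS (Lz) => i Gi; split.
    apply: filterS (nLz) => i nGi; split=> [/nGi//|Lz].
    by have [j [/= ? []]] := filter_ex (filterI Lz nLz).
  apply: filterS (filterI Uz IH) => i [/= Giz Gis] w.
  by rewrite in_cons => /predU1P[->|/Gis].
(* A minimal cut [F] of a point [a] of [L] lies in [L]: it is absorbed by every minimal cut of a
   [v j] that contains [a]. *)
have oL : open L.
  rewrite openE => a La; have [i [D mD Da]] := filter_ex La.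
  have [[oD _ DN fD] _] := mD.
  have [F mF] : exists F, mincut N a F by apply: (@mincut_exists _ _ _ D).
  have [[oF Fa _ _] _] := mF.
  apply: (filterS _ (open_nbhs_nbhs (conj oF Fa))) => b Fb.
  apply: filterS (La) => j [E mE Ea]; exists (E `|` F); last by right.
  exact: mincutU mE mF Ea.
have fL : finite_set (boundary L).
  apply: (finite_boundary_limit (k := bsize D0)) => // s.
  have [i Gis] := filter_ex (LU s).
  have [|z|D mD Ds] := @mincut_cover _ N (v i) [seq z <- s | `[< G i z >]].
  - by exists (A i).
  - by rewrite mem_filter => /andP[/asboolP].
  exists D; have [[oD _ _ fD] _] := mD; split=> //; first by rewrite (bA _ _ mD).
  move=> z zs; split=> [Dz|Lz]; first by apply/(Gis z zs); exists D.
  by apply: Ds; rewrite mem_filter zs andbT; apply/asboolP/(Gis z zs).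
have Lv i : ~ L (v i).
  move=> Lvi; have [j [/= Gj]] := filter_ex (filterI Lvi (Uge i.+1)).
  by move=> ij; apply: (@Gdistinct j i) => //; rewrite gtn_eqF.
(* For [i] in [J], the connected set [A i] contains [y] in [L] and [v i] outside [L], so it meets
   the finite boundary of [L]. The ultrafilter selects one boundary point [b] common to almost all
   [A i]. *)
have [b Lb Ub] : exists2 b, boundary L b & U [set i | A i b].
  apply: contrapT => nb.
  have : U (\bigcap_(b in [set` fset_set (boundary L)]) [set i | ~ A i b]).
    apply: filter_bigI => b; rewrite in_fset_set// inE => Lb.
    by have [Ub|//] := in_ultra_setVsetC [set i | A i b] UU; case: nb; exists b.
  move=> /(filterI UJ) /filter_ex[i [Aiy nAi]].
  have cA : connected (A i).
    have -> : A i = iter i f @` D0.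
      apply/seteqP; split=> [z Az|_ [z Dz <-]]; last first.
        by rewrite /A/preimage/= (iter_can fK).
      by exists (iter i g z) => //; rewrite (iter_can gK).
    apply: connected_continuous_connected => //.
    by apply: continuous_subspaceT; exact: iter_continuous.
  have [||b [Ab Lb]] := connected_meets_boundary cA oL.
  - exists y; split=> //; apply: filterS UJ => j Aj; exists (A j) => //.
  - by move=> /(_ (v i)) AL; apply: (Lv i); apply: AL; have [[]] := mA i.
  - by apply: (nAi b) => //=; rewrite in_fset_set// inE.
have : L b by apply: filterS Ub => i Aib; exists (A i).
by move: Lb; rewrite open_boundaryE// => -[].
Qed.

Lemma exists_forward_cut (q : T) : (exists D, finite_cut N q D) ->
  (forall D, open D -> D q ->
    exists y, forall m, exists2 i, (m <= i)%N & D (iter i g y)) ->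
  exists D, finite_cut N q D /\ finite_set (boundary (forward_union D)).
Proof.
move=> [D cD] rec; have [D1 /(mincut_component cT) mD1] := mincut_exists cD.
have [[oD1 D1q _ _] _] := mD1; have [y yD1] := rec _ oD1 D1q.
have [|h [E [h0 mE Eh]]] := minimal_cut_returns mD1 _ yD1.
  exact: component_connected.
by exists E; split; [have [] := mE|exact: finite_boundary_periodic h0 mE Eh].
Qed.

End ForwardUnion.

(** * Alpha-limit sets *)

Lemma image_invariant (T : Type) (f g : T -> T) (A : set T) :
  cancel f g -> cancel g f ->
  (f @` A = A) <-> (forall z, A (f z) <-> A z).
Proof.
move=> fK gK; split=> [fA z|fA].
  split=> [Afz|Az]; last by rewrite -fA; exists z.
  by move: Afz; rewrite -{1}fA => -[w Aw /(can_inj fK) <-].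
apply/seteqP; split=> [_ [z Az <-]|z Az]; first exact/fA.
by exists (g z); [apply/fA|]; rewrite gK.
Qed.

Lemma minimal_set_inverse (T : topologicalType) (f g : T -> T) (M : set T) :
  cancel f g -> cancel g f -> minimal_set f M -> minimal_set g M.
Proof.
move=> fK gK.
have inv A : g @` A = A <-> f @` A = A.
  split=> [/(image_invariant _ gK fK) gA|/(image_invariant _ fK gK) fA].
    by apply/(image_invariant _ fK gK) => z; rewrite -(gA (f z)) fK.
  by apply/(image_invariant _ gK fK) => z; rewrite -(fA (g z)) gK.
move=> [[M0 cM /inv gM] Mmin]; split=> // N NM [N0 cN /inv fN].
by apply: Mmin NM _.
Qed.

Section AlphaLimit.
Context {T : topologicalType} (f g : T -> T).
Hypotheses (fK : cancel f g) (gK : cancel g f).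
Hypotheses (cf : continuous f) (cg : continuous g).
Hypothesis compT : compact [set: T].
Implicit Types (A D M : set T) (y z : T).

Definition alpha_limit y : set T := cluster (iter i g y @[i --> \oo]).

Lemma alpha_limitP y z : alpha_limit y z <->
  forall B, nbhs z B -> forall m, exists2 i, (m <= i)%N & B (iter i g y).
Proof.
split=> [az B Bz m|az A B [m _ mA] Bz].
  have [|w [[i mi <-] Bw]] := az [set iter i g y | i in [set i | (m <= i)%N]] B _ Bz.
    by exists m => // i mi; exists i.
  by exists i.
by have [i mi Bi] := az B Bz m; exists (iter i g y); split=> //; exact: mA.
Qed.

Lemma closed_alpha_limit y : closed (alpha_limit y).
Proof.
rewrite /alpha_limit clusterE; apply: closed_bigI => A _.
exact: closed_closure.
Qed.

Lemma alpha_limit_invariant y z : alpha_limit y (f z) <-> alpha_limit y z.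
Proof.
split=> /alpha_limitP az; apply/alpha_limitP => B Bz m.
  have [|[|i] mi Bi] := az (g @^-1` B) _ m.+1; [|by []|].
    by apply: cg; rewrite fK.
  by exists i.+2; [exact: (leqW (leqW mi))|].
(* Asking for time at least [m.+1] leaves room for the step back in time that [f] makes. *)
have [|[|i] mi Bi] := az (f @^-1` B) _ m.+1; [exact: cf|by []|].
by exists i => //; move: Bi; rewrite /preimage/= gK.
Qed.

(** Time 0 is exempt because [limit_exit_point] controls only the strictly backward orbit. *)
Lemma alpha_limit_sub y A : closed A -> (forall i, (0 < i)%N -> A (iter i g y)) ->
  alpha_limit y `<=` A.
Proof.
move=> cA Ay z /alpha_limitP az; apply: cA => B /az/(_ 1%N)[i i0 Bi].
by exists (iter i g y); split=> //; exact: Ay.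
Qed.

Lemma alpha_limit_near y D : open D -> alpha_limit y `<=` D ->
  exists m, forall i, (m <= i)%N -> D (iter i g y).
Proof.
move=> oD aD.
have cD : compact (~` D) by apply: subclosed_compact compT _ => //; exact: open_closedC.
have [|m _ mD] := (compact_near_coveringP _).1 cD nat \oo
  (fun i z => iter i g y <> z).
  move=> z nDz; have : ~ alpha_limit y z by move=> /aD.
  move=> /alpha_limitP/existsNP[B /not_implyP[Bz /existsNP[m nB]]].
  exists (B, [set i | (m <= i)%N]) => /=; first by split=> //; exists m.
  by move=> [w i]/= [Bw mi] yw; apply: nB; exists i => //; rewrite yw.
by exists m => i mi; apply: contrapT => nDi; exact: (mD i mi _ nDi).
Qed.

Lemma alpha_limit_neq0 y : alpha_limit y !=set0.
Proof.
apply: contrapT => a0; have [|m /(_ m)[]//] := @alpha_limit_near y set0 open0.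
by move=> z az; apply: a0; exists z.
Qed.

(** The alpha-limit set of [y] is a closed invariant subset of [M], hence all of [M]. *)
Lemma minimal_set_recurrent M D y : minimal_set f M -> M y -> open D ->
  M `&` D !=set0 -> forall m, exists2 i, (m <= i)%N & D (iter i g y).
Proof.
move=> [[_ cM /(image_invariant _ fK gK) Mf] Mmin] My oD [w [Mw Dw]].
have Mg z : M (g z) <-> M z by rewrite -(Mf (g z)) gK.
have aM : alpha_limit y `<=` M.
  by apply: alpha_limit_sub => // i _; exact/iter_invariant.
suff : alpha_limit y w by move=> /alpha_limitP/(_ D); apply; exact: open_nbhs_nbhs.
apply: contrapT => naw; apply: (Mmin (alpha_limit y)).
  by split=> // /(_ w Mw).
split; [exact: alpha_limit_neq0|exact: closed_alpha_limit|].
by apply/(image_invariant _ fK gK); exact: alpha_limit_invariant.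
Qed.

End AlphaLimit.

(** * Limits of minimal sets *)

Lemma normal_separation (T : topologicalType) (N W : set T) :
  normal_space T -> closed N -> open W -> N `<=` W ->
  exists V, [/\ open V, N `<=` V & closure V `<=` W].
Proof.
move=> nT cN oW NW; have [|B] := nT N cN W; first by apply/set_nbhsP; exists W; split.
move=> /set_nbhsP[V [oV NV VB]] BW; exists V; split=> //.
exact: subset_trans (closure_subset VB) BW.
Qed.

(** Injectivity of [g] makes [x] itself periodic, not merely eventually periodic. *)
Lemma periodic_of_finite_orbit (T : Type) (f g : T -> T) (x : T) (B : set T) m :
  cancel g f -> finite_set B -> (forall i, (m <= i)%N -> B (iter i g x)) ->
  exists2 h, (0 < h)%N & iter h g x = x.
Proof.
move=> gK fB Bx; apply: contrapT => nper; apply: infinite_nat.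
have -> : [set: nat] = (fun i => iter (m + i) g x) @^-1` B.
  by apply/seteqP; split=> // i _; apply: Bx; exact: leq_addr.
apply: finite_preimage => // i j _ _; wlog ij : i j / (i <= j)%N.
  by move=> H; have [/H//|/ltnW/H{}H /esym/H] := leqP i j.
move: ij; rewrite leq_eqVlt => /predU1P[//|ij].
have -> : (m + j = (m + i) + (j - i))%N by rewrite -addnA subnKC// ltnW.
rewrite [X in _ = X -> _]iterD => /(can_inj (iter_can gK (m + i))) E; case: nper.
by exists (j - i)%N; rewrite ?subn_gt0.
Qed.

Section LimitOfMinimalSets.
Context {T : topologicalType} (f g : T -> T).
Hypotheses (fK : cancel f g) (gK : cancel g f).
Hypotheses (cf : continuous f) (cg : continuous g).
Hypotheses (compT : compact [set: T]) (hT : hausdorff_space T).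
Hypothesis cT : connected_nbhs T.
Hypothesis cuts : forall (N : set T) q, closed N -> ~ N q -> exists D, finite_cut N q D.
Context (M_ : nat -> set T) (M : set T).
Hypothesis minM_ : forall n, minimal_set f (M_ n).
Hypotheses (M0 : M !=set0) (cM : closed M).
(** Hausdorff convergence enters in its topological form, split into a lower and an upper half. *)
Hypothesis lowerM : forall x B, M x -> nbhs x B ->
  \forall n \near \oo, M_ n `&` B !=set0.
Hypothesis upperM : forall C, closed C -> C `&` M = set0 ->
  \forall n \near \oo, M_ n `&` C = set0.

Let nT : normal_space T := compact_normal hT compT.

Let invM_ n z : M_ n (f z) <-> M_ n z.
Proof. by have [[_ _ /(image_invariant _ fK gK)]] := minM_ n. Qed.

Lemma limit_mem x :
  (forall B, nbhs x B -> \forall n \near \oo, M_ n `&` B !=set0) -> M x.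
Proof.
move=> xB; apply: contrapT => nMx.
have cx : closed [set x] by exact/accessible_closed_set1/hausdorff_accessible.
have [V [oV xV VM]] : exists V, [/\ open V, [set x] `<=` V & closure V `<=` ~` M].
  by apply: normal_separation => //; [exact: closed_openC|move=> y ->].
have /xB n1 : nbhs x V by apply: open_nbhs_nbhs; split=> //; exact: xV.
have /upperM n2 : closure V `&` M = set0.
  by rewrite -subset0 => y [/VM].
have [n [[y [My Vy]] n0]] := filter_ex (filterI n1 (n2 (@closed_closure _ V))).
suff : (M_ n `&` closure V) y by rewrite n0.
by split=> //; exact: subset_closure.
Qed.

Lemma limit_invariant z : M (f z) <-> M z.
Proof.
split=> Mz; apply: limit_mem => B Bz.
  have /(lowerM Mz) : nbhs (f z) (g @^-1` B) by apply: cg; rewrite fK.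
  apply: filterS => n [y [My By]]; exists (g y); split=> //.
  by apply/invM_; rewrite gK.
have /(lowerM Mz) : nbhs z (f @^-1` B) by exact: cf.
by apply: filterS => n [y [My By]]; exists (f y); split=> //; apply/invM_.
Qed.

(** For large [n], minimality brings the [g]-orbit of every point of [M_ n] back to a given open set
    around [q] infinitely often. This supplies the recurrent point needed for the cut, and then puts
    [M_ n] inside the forward union. *)
Lemma limit_forward_cut N q : closed N -> (forall z, N (f z) <-> N z) ->
  M q -> ~ N q -> exists D, [/\ finite_cut N q D,
    finite_set (boundary (forward_union g D)) & M `<=` closure (forward_union g D)].
Proof.
move=> cN Nf Mq nNq.
have recM D : open D -> D q -> \forall n \near \oo, forall y, M_ n y ->
    forall m, exists2 i, (m <= i)%N & D (iter i g y).
  move=> oD Dq; have := lowerM Mq (open_nbhs_nbhs (conj oD Dq)).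
  apply: filterS => n MD y My m.
  exact: (minimal_set_recurrent fK gK cf cg compT (minM_ n) My oD MD m).
have [|D [cD fD]] := exists_forward_cut fK gK cf cg hT cT Nf (cuts cN nNq).
  move=> D oD Dq; have [n nD] := filter_ex (recM D oD Dq).
  by have [[[y My] _ _] _] := minM_ n; exists y; exact: nD.
exists D; split=> // x Mx B Bx; have [oD Dq _ _] := cD.
have [n [[y [My By]] nD]] := filter_ex (filterI (lowerM Mx Bx) (recM D oD Dq)).
by exists y; split=> //; have [i _ Di] := nD y My 0%N; exists i.
Qed.

Lemma limit_invariant_subset_finite N q : closed N ->
  (forall z, N (f z) <-> N z) -> N `<=` M -> M q -> ~ N q -> finite_set N.
Proof.
move=> cN Nf NM Mq nNq; have [D [[oD _ DN _] fD MD]] := limit_forward_cut cN Nf Mq nNq.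
apply: sub_finite_set fD => z Nz; rewrite open_boundaryE; last first.
  apply: bigcup_open => i _; apply: open_comp => // y _.
  exact: (@iter_continuous _ g cg i).
split; first exact/MD/NM.
move=> [i _ Di]; apply: (DN _ (@subset_closure _ D _ Di)).
have Ng y : N (g y) <-> N y by rewrite -(Nf (g y)) gK.
exact/(iter_invariant i z Ng).
Qed.

(** Otherwise the backward orbit of [q] finally avoids a cut [D] of [q] from its alpha-limit set. It
    is then in the closure of the forward union but not in the union, hence in a finite boundary. So
    [q] is periodic and returns to [D] at arbitrarily late times. *)
Lemma limit_recurrent q : M q -> alpha_limit g q q.
Proof.
move=> Mq; apply: contrapT => naq.
have ainv := alpha_limit_invariant fK gK cf cg q.
have [D [[oD Dq DN _] fD MD]] :=
  limit_forward_cut (@closed_alpha_limit _ g q) ainv Mq naq.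
have [||m mD] := @alpha_limit_near _ g compT q (~` closure D).
- by apply: closed_openC; exact: closed_closure.
- by move=> z az /DN.
have Mg z : M (g z) <-> M z by rewrite -(limit_invariant (g z)) gK.
have oU : open (forward_union g D).
  apply: bigcup_open => i _; apply: open_comp => // y _.
  exact: (@iter_continuous _ g cg i).
have [|h h0 hq] := @periodic_of_finite_orbit _ f g q _ m gK fD.
  move=> i mi; rewrite open_boundaryE//; split.
    by apply: MD; apply/(iter_invariant i q Mg).
  move=> [j _]; rewrite /preimage/= -iterD => Dij.
  by apply: (mD (j + i)%N); [rewrite (leq_trans mi)// leq_addl|exact: subset_closure].
have kq k : iter (k * h) g q = q.
  by elim: k => // k IH; rewrite mulSn iterD IH.
apply: (mD (m * h)%N); first by rewrite leq_pmulr.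
by rewrite kq; exact: subset_closure.
Qed.

(** A point of [M_ n] close to [p] stays in [V] for more than [m] steps of [f] but leaves [V] later;
    at its first exit the last [m] positions were in [V]. The limits over [n] and then over [m] give
    [z]. *)
Lemma limit_exit_point (N V : set T) p x : (forall z, N (f z) <-> N z) ->
  N p -> M p -> open V -> N `<=` V -> M x -> ~ closure V x ->
  exists z, [/\ M z, ~ V z & forall j, (0 < j)%N -> closure V (iter j g z)].
Proof.
move=> Nf Np Mp oV NV Mx nVx.
pose C m := ~` V `&` \bigcap_(j in [set j | (0 < j <= m)%N]) (iter j g @^-1` closure V).
have cC m : closed (C m).
  apply: closedI; first exact: open_closedC.
  apply: closed_bigI => j _; apply: preimage_closed; last exact: closed_closure.
  by move=> y _; exact: (@iter_continuous _ g cg j).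
have CM m : exists z, M z /\ C m z.
  apply: contrapT => nCM; have /(upperM (cC m)) n1 : C m `&` M = set0.
    by rewrite -subset0 => z [Cz Mz]; apply: nCM; exists z.
  pose fV i := iter i f @^-1` V; pose W := \big[setI/setT]_(i < m.+1) fV i.
  have oW : open W.
    apply: big_ind => [||i _]; [exact: openT|exact: openI|].
    by apply: open_comp => // y _; exact: (@iter_continuous _ f cf i).
  have Wp : W p.
    rewrite /W -bigcap_mkord => i _; apply: NV.
    exact/(iter_invariant i p Nf).
  have n2 := lowerM Mp (open_nbhs_nbhs (conj oW Wp)).
  have oVC : open (~` closure V) by apply: closed_openC; exact: closed_closure.
  have n3 := lowerM Mx (open_nbhs_nbhs (conj oVC nVx)).
  have [n [MC0 [[y [My Wy]] Mn]]] := filter_ex (filterI n1 (filterI n2 n3)).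
  (* Recurrence is applied with [f] and [g] exchanged, so that the forward orbit leaves
     [closure V]. *)
  have [i0 _ Vi0] := minimal_set_recurrent gK fK cg cf compT
    (minimal_set_inverse fK gK (minM_ n)) My oVC Mn 0%N.
  have exi : exists i, `[< ~ V (iter i f y) >].
    by exists i0; apply/asboolP => Vi; apply: Vi0; exact: subset_closure.
  case: (ex_minnP exi) => i /asboolP nVi imin.
  have mi : (m < i)%N.
    rewrite ltnNge; apply/negP => im; apply: nVi.
    by move: Wy; rewrite /W -bigcap_mkord => /(_ i); apply; rewrite /= ltnS.
  suff : (M_ n `&` C m) (iter i f y) by rewrite MC0.
  split; first exact/(iter_invariant i y (invM_ n)).
  split=> // j /= /andP[j0 jm]; apply: subset_closure; apply: contrapT => nVj.
  have ji : (j <= i)%N by rewrite (leq_trans jm)// ltnW.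
  have : ~ V (iter (i - j) f y).
    by move: nVj; rewrite -{1}(subnKC ji) iterD (iter_can fK).
  by move=> /asboolP/imin; rewrite leqNgt ltn_subrL j0 (leq_ltn_trans _ mi).
have /choice[z_ zP] := CM.
have [z [_ az]] := @compT (z_ n @[n --> \oo]) _ filterT.
have clz A m : closed A -> (forall n, (m <= n)%N -> A (z_ n)) -> A z.
  move=> cA Az; apply: cA => B Bz.
  have [|_ [[n mn <-] Bn]] := az [set z_ n | n in [set n | (m <= n)%N]] B _ Bz.
    by exists m => // n mn; exists n.
  by exists (z_ n); split=> //; exact: Az.
have Cz m : C m z.
  apply: (clz _ m) => // n mn; have [_ [nVz zV]] := zP n.
  split=> // j /andP[j0 jm]; apply: zV; rewrite /= j0.
  exact: leq_trans jm mn.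
exists z; split.
- by apply: (clz _ 0%N) => // n _; have [] := zP n.
- by have [] := Cz 0%N.
- by move=> j j0; have [_ /(_ j)] := Cz j; apply; rewrite /= j0/=.
Qed.

Lemma limit_minimal : minimal_set f M.
Proof.
split; first by split=> //; apply/(image_invariant _ fK gK); exact: limit_invariant.
move=> N [NM MN] [[p Np] cN /(image_invariant _ fK gK) Nf].
have [x [Mx nNx]] : exists x, M x /\ ~ N x.
  by apply: contrapT => nx; apply: MN => x Mx; apply: contrapT => nNx; apply: nx; exists x.
have hC := accessible_finite_set_closed.1 (hausdorff_accessible hT).
have Ng z : N (g z) <-> N z by rewrite -(Nf (g z)) gK.
have Mg z : M (g z) <-> M z by rewrite -(limit_invariant (g z)) gK.
have [V0 [oV0 NV0 V0x]] : exists V, [/\ open V, N `<=` V & closure V `<=` ~` [set x]].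
  apply: normal_separation => //; first by apply: closed_openC; apply: hC.
  by move=> y Ny yx; apply: nNx; rewrite -yx.
(* The largest invariant part of [M] inside [closure V0]; it is finite because it misses [x]. *)
pose A := M `&` \bigcap_i ((iter i f @^-1` closure V0) `&` (iter i g @^-1` closure V0)).
have cA : closed A.
  apply: closedI => //; apply: closed_bigI => i _; apply: closedI;
    apply: preimage_closed; try exact: closed_closure; move=> y _.
    exact: (@iter_continuous _ f cf i).
  exact: (@iter_continuous _ g cg i).
have Af z : A (f z) <-> A z.
  split=> -[Mz Vz]; (split; first exact/limit_invariant) => i _; split.
  - case: i => [|i]; first by have [_] := Vz 1%N I; rewrite /preimage/= fK.
    by have [Vi _] := Vz i I; move: Vi; rewrite /preimage/= -iterSr.
  - by have [_ Vi] := Vz i.+1 I; move: Vi; rewrite /preimage/mkset iterSr fK.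
  - by have [Vi _] := Vz i.+1 I; move: Vi; rewrite /preimage/mkset iterSr.
  - case: i => [|i]; first by have [] := Vz 1%N I.
    by have [_ Vi] := Vz i I; rewrite /preimage/mkset iterSr fK.
have fA : finite_set A.
  apply: (@limit_invariant_subset_finite A x) => // [z []//|[_ /(_ 0%N I)[]]].
  by rewrite /preimage/= => /V0x/(_ erefl).
(* The set [A] without [N] is finite, hence closed, so [V] can be shrunk until its closure avoids
   it. *)
have [V [oV NV VW]] : exists V,
    [/\ open V, N `<=` V & closure V `<=` V0 `&` ~` (A `\` N)].
  apply: normal_separation => //.
    by apply: openI => //; apply: closed_openC; apply: hC; exact: finite_setD.
  by move=> y Ny; split; [exact: NV0|move=> []].
have VV0 : closure V `<=` closure V0 by move=> y /VW[/subset_closure].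
have [||z [Mz nVz zV]] := @limit_exit_point N V p x Nf Np _ oV NV Mx.
- exact: NM.
- by move=> /VV0/V0x/(_ erefl).
have aV : alpha_limit g z `<=` closure V.
  by apply: alpha_limit_sub => //; exact: closed_closure.
have aM : alpha_limit g z `<=` M.
  by apply: alpha_limit_sub => // i _; exact/(iter_invariant i z Mg).
have af := alpha_limit_invariant fK gK cf cg z.
have ag w : alpha_limit g z (g w) <-> alpha_limit g z w by rewrite -(af (g w)) gK.
have az := limit_recurrent Mz.
(* By recurrence [z] is in its own invariant alpha-limit set, so its whole orbit stays in
   [closure V] and [z] is in [A]. *)
apply: nVz; apply: NV; apply: contrapT => nNz.
have [_ nAN] := VW _ (aV _ az).
apply: nAN; split=> //; split=> // i _; split; apply/VV0/aV; exact/iter_invariant.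
Qed.

End LimitOfMinimalSets.

(** * Hausdorff convergence *)

Local Open Scope ring_scope.

Section HausdorffDistance.
Context {R : realType} {X : metricType R}.
Hypothesis compX : compact [set: X].
Implicit Types (A B C : set X) (e : R).

(** This bound makes the suprema in [hausdorff_dist] genuine instead of the default value 0. *)
Lemma compact_mdist_bounded : exists K, forall x y : X, mdist x y <= K.
Proof.
have [x0|nX] := pselect (exists x0 : X, True); last first.
  by exists 0 => x; case: nX; exists x.
have [x _] := x0.
have [|K [_ KX]] := (compact_near_coveringP _).1 compX R +oo (fun K z => mdist x z < K).
  move=> z _; exists (ball z 1, [set K | mdist x z + 1 < K]) => /=.
    split; first exact: nbhsx_ballx.
    by apply: nbhs_pinfty_gt; exact: num_real.
  move=> [w K]/=; rewrite ballEmdist/= => -[zw]; apply: lt_trans.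
  by rewrite (le_lt_trans (metric_triangle x z w))// ltrD2l.
exists ((K + 1) + (K + 1)) => y z.
have K1 : forall w, mdist x w < K + 1.
  by move=> w; apply: (KX (K + 1)); rewrite // ltrDl.
by rewrite (le_trans (metric_triangle y x z))// metric_sym lerD// ltW.
Qed.

Lemma dist_to_set_le_sup A B x : A !=set0 -> B !=set0 -> A x ->
  dist_to_set x B <= sup [set dist_to_set x B | x in A].
Proof.
move=> A0 [b Bb] Ax; apply: ub_le_sup; last by exists x.
have [K dK] := compact_mdist_bounded.
exists K => _ [y _ <-]; apply: le_trans (dK y b).
apply: ge_inf; last by exists b.
by exists 0 => _ [z _ <-]; exact: mdist_ge0.
Qed.

Lemma dist_to_set_lt e x B : B !=set0 -> dist_to_set x B < e ->
  exists2 b, B b & mdist x b < e.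
Proof.
move=> [b Bb] /inf_lt[|_ [c Bc <-] xc]; last by exists c.
by exists (mdist x b), b.
Qed.

Lemma hausdorff_dist_lt e A B : A !=set0 -> B !=set0 -> hausdorff_dist A B < e ->
  (forall a, A a -> exists2 b, B b & mdist a b < e) /\
  (forall b, B b -> exists2 a, A a & mdist b a < e).
Proof.
move=> A0 B0; rewrite /hausdorff_dist gt_max => /andP[ABe BAe].
split=> x xA; apply: dist_to_set_lt => //.
  exact: le_lt_trans (dist_to_set_le_sup A0 B0 xA) ABe.
exact: le_lt_trans (dist_to_set_le_sup B0 A0 xA) BAe.
Qed.

Context (A_ : nat -> set X) (A : set X).
Hypotheses (A_0 : forall n, A_ n !=set0) (A0 : A !=set0) (cA : closed A).
Hypothesis A_A : hausdorff_dist (A_ n) A @[n --> \oo] --> (0 : R).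

Let near_lt e : 0 < e -> \forall n \near \oo, hausdorff_dist (A_ n) A < e.
Proof.
by move=> /(cvgr0_norm_lt _ A_A); apply: filterS => n; exact/le_lt_trans/ler_norm.
Qed.

Lemma hausdorff_cvg_lower x B : A x -> nbhs x B ->
  \forall n \near \oo, A_ n `&` B !=set0.
Proof.
move=> Ax /nbhs_ballP[e /= e0 eB]; apply: filterS (near_lt e0) => n nA.
have [_ /(_ x Ax)[y Any xy]] := hausdorff_dist_lt (A_0 n) A0 nA.
by exists y; split=> //; apply: eB; rewrite ballEmdist.
Qed.

(** The compact set [C] has a positive distance [d] from [A], so no point of [C] is within [d] of
    [A]. *)
Lemma hausdorff_cvg_upper C : closed C -> C `&` A = set0 ->
  \forall n \near \oo, A_ n `&` C = set0.
Proof.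
move=> cC CA0.
have cptC : compact C by exact: subclosed_compact cC compX _.
have [|e [/= e0 eC]] := (compact_near_coveringP _).1 cptC R 0^'+
  (fun e z => forall a, A a -> e <= mdist z a).
  move=> z Cz; have nAz : ~ A z by move=> Az; suff : (C `&` A) z by rewrite CA0.
  have /nbhs_ballP[d /= d0 dA] : nbhs z (~` A).
    by apply: open_nbhs_nbhs; split=> //; exact: closed_openC.
  exists (ball z (d / 2), [set e | e < d / 2]) => /=.
    split; first by apply: nbhsx_ballx; rewrite divr_gt0.
    by apply: nbhs_right_lt; rewrite divr_gt0.
  move=> [w e]/=; rewrite ballEmdist/= => -[zw ed] a Aa.
  rewrite leNgt; apply/negP => wa; apply: (dA a) => //.
  rewrite ballEmdist/= (le_lt_trans (metric_triangle z w a))//.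
  by rewrite [d]splitr ltrD// (lt_trans wa).
have [d d0 dC] : exists2 d, 0 < d & forall z, C z -> forall a, A a -> d <= mdist z a.
  exists (e / 2); first by rewrite divr_gt0.
  apply: (eC (e / 2)) => /=; last by rewrite divr_gt0.
  by rewrite sub0r normrN gtr0_norm ?divr_gt0// ltr_pdivrMr// ltr_pMr// ltr1n.
apply: filterS (near_lt d0) => n /(hausdorff_dist_lt (A_0 n) A0)[nA _].
rewrite -subset0 => z [/nA[a Aa za] Cz].
by have := dC z Cz a Aa; rewrite leNgt za.
Qed.

End HausdorffDistance.

Theorem theorem2p2 (R : realType) (X : metricType R) (f : X -> X)
    (M_ : nat -> set X) (M : set X) :
  regular_curve X ->
  homeomorphism f ->
  (forall n, minimal_set f (M_ n)) ->
  hyperspace M ->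
  hausdorff_dist (M_ n) M @[n --> \oo] --> (0 : R) ->
  minimal_set f M.
Proof.
move=> [[_ cX compX] reg] [cf [g [fK gK cg]]] minM_ [M0 cM] M_M.
have M_0 n : M_ n !=set0 by have [[]] := minM_ n.
have rX : regular_space X := uniform_regular.
have cT := connected_nbhs_of_finite_boundary cX rX reg.
apply: (limit_minimal fK gK cf cg compX (metric_hausdorff (T := X)) cT _ minM_) => //.
(* Regularity of the space shrinks the complement of [N] first, so that the closure of the cut still
   avoids [N]. *)
- move=> N q cN nNq.
  have [W qW WN] := rX q _ (open_nbhs_nbhs (conj (closed_openC cN) nNq)).
  have [U [[oU Uq] UW fU]] := reg q W° (conj (open_interior W) qW).
  exists U; split=> //; apply: subset_trans WN; apply: closure_subset.
  by apply: subset_trans UW _; exact: interior_subset.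
- by move=> x B; exact: (hausdorff_cvg_lower compX M_0 M0 M_M).
- by move=> C; exact: (hausdorff_cvg_upper compX M_0 M0 cM M_M).
Qed.
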